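(* Let $\widehat{A}=A+\varepsilon B$ be an $n\times n$ dual matrix with $A,B\in\mathbb{R}^{n\times n}$ and $\mathrm{rank}(A)=r$. Then the dual index of $\widehat{A}$ is one if and only if $\mathrm{Ind}(A)=1$ and $(I_n-AA^{+})B(I_n-A^{+}A)=0$.
   Context: Dual numbers are $a+\varepsilon a'$ with $a,a'\in\mathbb{R}$ and $\varepsilon\neq 0$, $\varepsilon^2=0$ (i.e. the ring $\mathbb{R}[\varepsilon]/(\varepsilon^2)$). A dual matrix is a matrix over dual numbers, written $\widehat{A}=A+\varepsilon B$ with $A,B$ real. The range $\mathcal{R}(\widehat{A})$ of an $n\times n$ dual matrix is $\{\widehat{A}\widehat{x}: \widehat{x}$ a dual column vector of length $n\}$. The dual index of an $n\times n$ dual matrix $\widehat{A}$ is said to be equal to one if $\mathcal{R}(\widehat{A}^2)=\mathcal{R}(\widehat{A})$. For a real square matrix $A$, ''$\mathrm{Ind}(A)=1$'' means $\mathrm{rank}(A^2)=\mathrm{rank}(A)$, and $A^{+}$ denotes the (real) Moore–Penrose inverse of $A$. *)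

(* Defs.v *)
From HB Require Import structures.
From mathcomp Require Import all_boot all_order all_algebra.
From mathcomp Require Import boolp classical_sets reals.
From mathcomp Require Import ring.

Set Implicit Arguments.
Unset Strict Implicit.
Unset Printing Implicit Defensive.

Import Order.TTheory GRing.Theory Num.Theory.
Local Open Scope classical_set_scope.
Local Open Scope ring_scope.

(* [Dual a b] stands for a + eps b.  This is a record rather than R * R, whose
   canonical ring structure is the componentwise one. *)
Record dualnum (R : Type) := Dual { dstd : R ; dinf : R }.

Section DualRing.
Context {R : comNzRingType}.
Implicit Types x y z : dualnum R.

Definition dual_pair x : R * R := (dstd x, dinf x).
Definition pair_dual (p : R * R) : dualnum R := Dual p.1 p.2.

Lemma dual_pairK : cancel dual_pair pair_dual.
Proof. by case. Qed.

HB.instance Definition _ := Choice.copy (dualnum R) (can_type dual_pairK).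

Definition dual_add x y := Dual (dstd x + dstd y) (dinf x + dinf y).
Definition dual_opp x := Dual (- dstd x) (- dinf x).
Definition dual_mul x y :=
  Dual (dstd x * dstd y) (dstd x * dinf y + dinf x * dstd y).

Lemma dual_addA : associative dual_add.
Proof. by move=> x y z; rewrite /dual_add /= !addrA. Qed.
Lemma dual_addC : commutative dual_add.
Proof. by move=> x y; congr Dual; rewrite addrC. Qed.
Lemma dual_add0 : left_id (Dual 0 0) dual_add.
Proof. by case=> a b; rewrite /dual_add /= !add0r. Qed.
Lemma dual_addN : left_inverse (Dual 0 0) dual_opp dual_add.
Proof. by move=> x; rewrite /dual_add /= !addNr. Qed.

HB.instance Definition _ :=
  GRing.isZmodule.Build (dualnum R) dual_addA dual_addC dual_add0 dual_addN.

Lemma dual_mulA : associative dual_mul.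
Proof. by move=> x y z; congr Dual => /=; ring. Qed.
Lemma dual_mulC : commutative dual_mul.
Proof. by move=> x y; congr Dual => /=; ring. Qed.
Lemma dual_mul1 : left_id (Dual 1 0) dual_mul.
Proof. by case=> a b; congr Dual => /=; ring. Qed.
Lemma dual_mulDl : left_distributive dual_mul +%R.
Proof. by move=> x y z; congr Dual => /=; ring. Qed.
Lemma dual_oner_neq0 : Dual 1 0 != 0 :> dualnum R.
Proof. by apply/eqP => -[] /eqP; rewrite oner_eq0. Qed.

HB.instance Definition _ := GRing.Zmodule_isComNzRing.Build (dualnum R)
  dual_mulA dual_mulC dual_mul1 dual_mulDl dual_oner_neq0.

Definition dreal (a : R) : dualnum R := Dual a 0.
Definition deps : dualnum R := Dual 0 1.

Lemma deps_neq0 : deps != 0.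
Proof. by apply/eqP => -[] /eqP; rewrite oner_eq0. Qed.

Lemma deps_sq : deps ^+ 2 = 0.
Proof. by congr Dual => /=; ring. Qed.

Lemma dualE x : x = dreal (dstd x) + deps * dreal (dinf x).
Proof. by case: x => a b; congr Dual => /=; ring. Qed.

End DualRing.

Definition dual_mx (R : comNzRingType) (m n : nat) (A B : 'M[R]_(m, n)) :
  'M[dualnum R]_(m, n) := map_mx dreal A + deps *: map_mx dreal B.

Lemma dual_mxE (R : comNzRingType) (m n : nat) (A B : 'M[R]_(m, n)) i j :
  dual_mx A B i j = Dual (A i j) (B i j).
Proof. by rewrite !mxE; congr Dual => /=; ring. Qed.

Definition dual_range (R : comNzRingType) (n : nat) (M : 'M[dualnum R]_n) :
  set 'cV[dualnum R]_n := [set M *m x | x in [set: 'cV[dualnum R]_n]].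

Definition dual_index_one (R : comNzRingType) (n : nat)
  (M : 'M[dualnum R]_n) : Prop := dual_range (M ^+ 2) = dual_range M.

Definition index_one (F : fieldType) (n : nat) (A : 'M[F]_n) : Prop :=
  \rank (A ^+ 2) = \rank A.

(* The four Penrose equations over a real field, where the conjugate transpose
   is the transpose. *)
Definition penrose (F : realFieldType) (m n : nat)
    (A : 'M[F]_(m, n)) (X : 'M[F]_(n, m)) : bool :=
  [&& A *m X *m A == A, X *m A *m X == X,
      (A *m X)^T == A *m X & (X *m A)^T == X *m A].

Lemma gram_unitmx (F : realFieldType) (m n : nat) (A : 'M[F]_(m, n)) :
  row_free A -> A *m A^T \in unitmx.
Proof.
move=> fA; rewrite -row_free_unit; apply: inj_row_free => v vAA0.
apply: (row_free_inj fA); rewrite /= mul0mx.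
have : (v *m A *m (v *m A)^T) 0 0 = 0.
  by rewrite trmx_mul mulmxA -(mulmxA v) vAA0 mul0mx mxE.
move: (v *m A) => w; rewrite mxE => /eqP; rewrite psumr_eq0 => [/allP w0|i _].
  apply/rowP => j; move: (w0 j (mem_index_enum _)).
  by rewrite /= !mxE mulf_eq0 orbb => /eqP.
by rewrite mxE -expr2 sqr_ge0.
Qed.

Lemma penrose_exists (F : realFieldType) (m n : nat) (A : 'M[F]_(m, n)) :
  exists X, penrose A X.
Proof.
move: (mulmx_base A) (row_base_free A) (col_base_full A).
move: (\rank A) (col_base A) (row_base A) => r P Q <- {A} fQ fP.
have uQ : Q *m Q^T \in unitmx by apply: gram_unitmx.
have uP : P^T *m P \in unitmx.
  have := @gram_unitmx _ _ _ P^T; rewrite trmxK; apply.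
  by rewrite /row_free mxrank_tr.
pose Y := invmx (P^T *m P) *m P^T; pose Z := Q^T *m invmx (Q *m Q^T).
have YP : Y *m P = 1%:M by rewrite -mulmxA mulVmx.
have QZ : Q *m Z = 1%:M by rewrite mulmxA mulmxV.
have AX : P *m Q *m (Z *m Y) = P *m Y by rewrite mulmxA -(mulmxA P) QZ mulmx1.
have XA : Z *m Y *m (P *m Q) = Z *m Q by rewrite mulmxA -(mulmxA Z) YP mulmx1.
exists (Z *m Y); rewrite /penrose AX XA; apply/and4P; split; apply/eqP.
- by rewrite mulmxA -(mulmxA P) YP mulmx1.
- by rewrite mulmxA -(mulmxA Z) QZ mulmx1.
- by rewrite !trmx_mul trmxK trmx_inv trmx_mul trmxK mulmxA.
- by rewrite !trmx_mul trmxK trmx_inv trmx_mul trmxK mulmxA.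
Qed.

Lemma penrose_unique (F : realFieldType) (m n : nat) (A : 'M[F]_(m, n)) X Y :
  penrose A X -> penrose A Y -> X = Y.
Proof.
case/and4P=> /eqP X1 /eqP X2 /eqP X3 /eqP X4.
case/and4P=> /eqP Y1 /eqP Y2 /eqP Y3 /eqP Y4.
have AXY : A *m X = A *m Y.
  by rewrite -X3 -{1}Y1 -mulmxA trmx_mul X3 Y3 mulmxA X1.
have XYA : X *m A = Y *m A.
  by rewrite -X4 -{1}Y1 -mulmxA mulmxA trmx_mul Y4 X4 -mulmxA mulmxA -(mulmxA Y) (mulmxA A) X1.
by rewrite -X2 XYA -mulmxA AXY mulmxA Y2.
Qed.

Definition mpinv (F : realFieldType) (m n : nat) (A : 'M[F]_(m, n)) :
  'M[F]_(n, m) := xchoose (penrose_exists A).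

Lemma mpinvP (F : realFieldType) (m n : nat) (A : 'M[F]_(m, n)) :
  penrose A (mpinv A).
Proof. exact: xchooseP. Qed.

(* Main.v *)
Require Import Defs.
From mathcomp Require Import all_boot all_order all_algebra.
From mathcomp Require Import boolp classical_sets reals.

(** Equality of the two ranges means that [Ahat = Ahat ^+ 2 *m X] has a dual
    solution [X = X0 + eps X1], that is, [A = A^2 X0] and
    [B = (A B + B A) X0 + A^2 X1].  Put [P = 1 - A A^+] and [N = 1 - A^+ A], so
    that [P A = 0] and [A N = 0].  Multiplying the second equation by [P] and [N]
    leaves [P B N = P B (A X0 N)], and [A X0 N = 0] because [A^2 X0 N = A N = 0]
    and [A^2] has the same kernel as [A].  Conversely, if [P B N = 0] and
    [A = A^2 X0], then [P B (1 - A X0) = P B A^+ (A - A^2 X0) = 0], so the columns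
    of [B - (A B + B A) X0] lie in the range of [A], which is that of [A^2]. *)

Import GRing.Theory.
Local Open Scope ring_scope.

Lemma dual_mx_surj (R : comNzRingType) (m n : nat) (M : 'M[dualnum R]_(m, n)) :
  M = dual_mx (map_mx (@dstd R) M) (map_mx (@dinf R) M).
Proof. by apply/matrixP => i j; rewrite dual_mxE !mxE; case: (M i j). Qed.

Lemma dual_mx_inj (R : comNzRingType) (m n : nat) (A B C D : 'M[R]_(m, n)) :
  dual_mx A B = dual_mx C D -> A = C /\ B = D.
Proof.
move=> e; split; apply/matrixP => i j;
  by move/matrixP: e => /(_ i j); rewrite !dual_mxE => -[].
Qed.

Lemma dual_sum (R : comNzRingType) (I : Type) (s : seq I) (F : I -> dualnum R) :
  \sum_(i <- s) F i = Dual (\sum_(i <- s) dstd (F i)) (\sum_(i <- s) dinf (F i)).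
Proof.
elim: s => [|i s IHs]; first by rewrite !big_nil.
by rewrite !big_cons IHs.
Qed.

Lemma mulmx_dual (R : comNzRingType) (m n p : nat)
    (A B : 'M[R]_(m, n)) (C D : 'M[R]_(n, p)) :
  dual_mx A B *m dual_mx C D = dual_mx (A *m C) (A *m D + B *m C).
Proof.
apply/matrixP => i j; rewrite dual_mxE !mxE dual_sum -big_split /=.
by congr Dual; apply: eq_bigr => k _; rewrite !dual_mxE.
Qed.

(** Each column of [M] lies in its range; preimages under [N], chosen column by column, assemble
    into [X]. *)
Lemma dual_range_subP (R : comNzRingType) (n : nat) (M N : 'M[dualnum R]_n) :
  (dual_range M `<=` dual_range N)%classic <-> exists X, M = N *m X.
Proof.
split=> [sMN | [X ->] _ [x _ <-]]; last by exists (X *m x); rewrite ?mulmxA.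
have colM j : exists x, N *m x = col j M.
  have [|x _ Nx] := sMN (col j M); last by exists x.
  by exists (delta_mx j 0) => //; rewrite colE.
have [f Nf] := choice colM; exists (\matrix_(i, j) f j i 0).
apply/matrixP => i j; have /matrixP/(_ i 0) := Nf j; rewrite !mxE => <-.
by apply: eq_bigr => k _; rewrite mxE.
Qed.

(** The range of [M ^+ 2] always lies in that of [M], so only the reverse inclusion is a
    condition. *)
Lemma dual_index_oneP (R : comNzRingType) (n : nat) (M : 'M[dualnum R]_n) :
  dual_index_one M <-> exists X, M = M *m M *m X.
Proof.
rewrite /dual_index_one expr2; split=> [e | ex].
  by apply/dual_range_subP; rewrite -[(M *m M)]/(M * M) e.
apply/seteqP; split; apply/dual_range_subP => //; by exists M.
Qed.

(** The row space of [A *m A] lies in that of [A], and equal ranks make them coincide. *)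
Lemma index_one_factorl (F : fieldType) (n : nat) (A : 'M[F]_n) :
  index_one A -> exists X, A = X *m (A *m A).
Proof.
rewrite /index_one expr2 => e; apply/submxP.
by have /mxrank_leqif_sup/geq_leqif <- := submxMl A A; rewrite -[A *m A]/(A * A) e.
Qed.

Lemma index_one_tr (F : fieldType) (n : nat) (A : 'M[F]_n) :
  index_one A -> index_one A^T.
Proof.
by rewrite /index_one !expr2 -[A^T * A^T]/(A^T *m A^T) -trmx_mul !mxrank_tr.
Qed.

Lemma index_oneP (F : fieldType) (n : nat) (A : 'M[F]_n) :
  index_one A <-> exists X, A = A *m A *m X.
Proof.
split=> [/index_one_tr/index_one_factorl[X e] | [X e]].
  by exists X^T; rewrite -{1}[A]trmxK {1}e !trmx_mul !trmxK.
rewrite /index_one expr2; apply/eqP; rewrite eqn_leq mxrankM_maxl /=.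
by rewrite {1}e mxrankM_maxl.
Qed.

Theorem theorem2p4 (R : realType) (n r : nat) (A B : 'M[R]_n)
    (hr : \rank A = r) :
  dual_index_one (dual_mx A B) <->
  index_one A /\
  (1%:M - A *m mpinv A) *m B *m (1%:M - mpinv A *m A) = 0.
Proof.
have /and4P[/eqP AGA _ _ _] := mpinvP A.
move: (mpinv A) AGA => G AGA.
set P := 1%:M - A *m G; set N := 1%:M - G *m A.
have PA : P *m A = 0 by rewrite mulmxBl mul1mx AGA subrr.
have AN : A *m N = 0 by rewrite mulmxBr mulmx1 mulmxA AGA subrr.
rewrite dual_index_oneP; split=> [[X] | [A1 PBN]].
  clearbody P N; rewrite (dual_mx_surj _ _ _ X) !mulmx_dual => /dual_mx_inj[].
  move: (map_mx _ X) (map_mx (@dinf R) X) => X0 X1 eA eB.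
  have A1 : index_one A by apply/index_oneP; exists X0.
  split=> //; have [Y eY] := index_one_factorl _ _ _ A1.
  (* [A = Y A^2] expresses that [A^2] has no larger kernel than [A]:
     [A X0 N = Y (A^2 X0) N = Y A N]. *)
  have AXN : A *m X0 *m N = 0.
    by rewrite {1}eY -!mulmxA (mulmxA A A) (mulmxA (A *m A)) -eA AN mulmx0.
  rewrite eB mulmxDl !mulmxDr !mulmxA PA !mul0mx !add0r.
  by rewrite -!mulmxA (mulmxA A) AXN !mulmx0.
have /index_oneP[X0 eA] := A1.
pose D := B - (A *m B + B *m A) *m X0.
have PBX : P *m B *m (1%:M - A *m X0) = 0.
  (* This is [P B N = 0] with [N] expanded. *)
  have -> : P *m B = P *m B *m G *m A.
    by apply/eqP; rewrite -subr_eq0 -PBN mulmxBr mulmx1 !mulmxA.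
  by rewrite -mulmxA mulmxBr mulmx1 mulmxA -eA subrr mulmx0.
have PD : P *m D = 0.
  by rewrite -PBX /D mulmxDl !mulmxBr mulmxDr !mulmxA PA !mul0mx add0r mulmx1.
(* [P D = 0] reads [D = A G D]; replacing [A] by [A^2 X0] yields the infinitesimal part [X0 G D] of
   the solution. *)
have DE : D = A *m A *m (X0 *m G *m D).
  by move/eqP: PD; rewrite mulmxBl mul1mx subr_eq0 !mulmxA -eA => /eqP.
exists (dual_mx X0 (X0 *m G *m D)).
by rewrite !mulmx_dual -eA -DE subrK.
Qed.
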